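(* Let $G$ be a finite simple connected edge transitive graph, let $\mathcal{K}$ be Kemeny's constant for $G$, and let $\{x,y\}$ be an edge of $G$. Then $\dfrac{d\mathcal{K}}{d\{x,y\}}=0$.
   Context: A graph is edge transitive if for every pair of edges $e_1,e_2$ there is a graph automorphism mapping $e_1$ to $e_2$. For a finite simple connected graph $G$ with at least two vertices, $A$ is the adjacency matrix, $d_x$ is the degree of the vertex $x$, $D$ is the diagonal matrix of degrees (invertible), and the normalized Laplacian is $\mathcal{L} = I - D^{-1/2} A D^{-1/2}$. Edge derivative of an eigenvalue: let $\lambda$ be an eigenvalue of $\mathcal{L}$ of multiplicity $k$, let $\mathbf{v}_1,\dots,\mathbf{v}_k$ be an orthonormal basis of the $\lambda$-eigenspace, and write $\mathbf{v}_{i,x}$ for the entry of $\mathbf{v}_i$ at the vertex $x$. For a pair $\{x,y\}$ of distinct vertices (adjacent or not), $$\frac{d\lambda}{d\{x,y\}} = \frac1k\sum_{i=1}^k\left[(1-\lambda)\left(\frac{\mathbf{v}_{i,x}^2}{d_x}+\frac{\mathbf{v}_{i,y}^2}{d_y}\right)-2\,\frac{\mathbf{v}_{i,x}\mathbf{v}_{i,y}}{\sqrt{d_xd_y}}\right].$$ This value does not depend on the choice of the orthonormal basis. Kemeny's constant of $G$ is $\mathcal{K}=\mathcal{K}(G)=\sum_{\lambda\ne 0}\frac1\lambda$, the sum being over the nonzero eigenvalues of $\mathcal{L}$ counted with multiplicity, and its edge derivative is $$\frac{d\mathcal{K}}{d\{x,y\}}=\sum_{\lambda\neq 0}-\frac{1}{\lambda^2}\,\frac{d\lambda}{d\{x,y\}},$$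 again over the nonzero eigenvalues counted with multiplicity. *)

(* Defs.v *)
From mathcomp Require Import all_boot all_order all_algebra all_fingroup.
From mathcomp Require Import polyrcf.

Set Implicit Arguments.
Unset Strict Implicit.
Unset Printing Implicit Defensive.

Import Order.TTheory GRing.Theory Num.Theory.
Local Open Scope ring_scope.

Section Graph.

Variables (T : finType) (e : rel T).

Definition simple_graph : Prop := symmetric e /\ irreflexive e.

Definition connected_graph : Prop := forall x y : T, connect e x y.

Definition graph_automorphism (s : {perm T}) : Prop :=
  forall x y : T, e (s x) (s y) = e x y.

(* Edges are unordered: the automorphism may exchange the two endpoints. *)
Definition edge_transitive : Prop :=
  forall x1 y1 x2 y2 : T, e x1 y1 -> e x2 y2 ->
  exists2 s : {perm T}, graph_automorphism s
                      & [set s z | z in [set x1; y1]] = [set x2; y2].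

Definition degree (x : T) : nat := #|[set y | e x y]|.

End Graph.

(* Matrices are indexed by 'I_#|T|; the vertex x has index enum_rank x. *)
Section NormalizedLaplacian.

Variables (R : rcfType) (T : finType) (e : rel T).

Definition adjacency_mx : 'M[R]_#|T| :=
  \matrix_(i, j) (e (enum_val i) (enum_val j))%:R.

Definition degree_invsqrt_mx : 'M[R]_#|T| :=
  diag_mx (\row_i (Num.sqrt (degree e (enum_val i))%:R)^-1).

Definition normalized_laplacian : 'M[R]_#|T| :=
  1%:M - degree_invsqrt_mx *m adjacency_mx *m degree_invsqrt_mx.

(* eigenspace is made of row vectors; the matrix being symmetric, these are
   the transposes of the usual eigenvectors. *)
Definition multiplicity (l : R) : nat :=
  \rank (eigenspace normalized_laplacian l).

(* The matrix being symmetric, this dimension is also the multiplicity of l as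
   a root of the characteristic polynomial. *)
Definition spectrum : seq R :=
  flatten [seq nseq (multiplicity l) l
          | l <- rootsR (char_poly normalized_laplacian)].

Definition orthonormal_eigenbasis (l : R)
    (B : 'M[R]_(multiplicity l, #|T|)) : Prop :=
  B *m B^T = 1%:M /\ (B :=: eigenspace normalized_laplacian l)%MS.

Definition eigenvalue_deriv (l : R) (B : 'M[R]_(multiplicity l, #|T|))
    (x y : T) : R :=
  (multiplicity l)%:R^-1 * \sum_(i < multiplicity l)
    ((1 - l) * (B i (enum_rank x) ^+ 2 / (degree e x)%:R
                + B i (enum_rank y) ^+ 2 / (degree e y)%:R)
     - 2 * (B i (enum_rank x) * B i (enum_rank y)
            / Num.sqrt ((degree e x)%:R * (degree e y)%:R))).

Definition kemeny : R := \sum_(l <- spectrum | l != 0) l^-1.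

(* The value does not depend on the orthonormal eigenbases B l. *)
Definition kemeny_deriv (B : forall l : R, 'M[R]_(multiplicity l, #|T|))
    (x y : T) : R :=
  \sum_(l <- spectrum | l != 0) - (l ^+ 2)^-1 * eigenvalue_deriv (B l) x y.

End NormalizedLaplacian.

(* Gram-Schmidt; hence orthonormal_eigenbasis is satisfiable for every l. *)
Lemma orthonormal_basis_exists (R : rcfType) (n r : nat) (U : 'M[R]_(r, n)) :
  row_free U -> exists2 B : 'M[R]_(r, n), B *m B^T = 1%:M & (B :=: U)%MS.
Proof.
elim: r U => [|r IHr] U freeU.
  by exists U => //; apply/matrixP=> -[].
rewrite -[r.+1]/(1 + r)%N in U freeU *.
pose u := usubmx U; pose U' := dsubmx U.
have defU : U = col_mx u U' by rewrite vsubmxK.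
have rkU : \rank (u + U')%MS = r.+1.
  by rewrite addsmxE -defU; apply/eqP.
have freeU' : row_free U'.
  rewrite /row_free eqn_leq rank_leq_row /= -ltnS -rkU.
  apply: leq_trans (mxrank_adds_leqif u U') _.
  by have := rank_leq_row u; rewrite -(leq_add2r (\rank U')) add1n.
have [B' oB eqB] := IHr U' freeU'.
pose w := u - u *m B'^T *m B'.
have wB : w *m B'^T = 0 by rewrite mulmxBl -!mulmxA oB mulmx1 subrr.
have wn0 : w != 0.
  apply: contraTneq isT => /subr0_eq uE.
  have /addsmx_idPr uU' : (u <= U')%MS by rewrite uE -eqB submxMl.
  by have := rkU; rewrite uU' (eqP freeU') => /n_Sn.
have nw : 0 < (w *m w^T) 0 0.
  move: (w) wn0 => z /rV0Pn[j zj]; rewrite mxE (bigD1 j) //= mxE ltr_pwDl //.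
    by rewrite -expr2 exprn_even_gt0.
  by apply: sumr_ge0 => k _; rewrite mxE -expr2 sqr_ge0.
pose c := (Num.sqrt ((w *m w^T) 0 0))^-1.
have cn0 : c != 0 by rewrite invr_eq0 gt_eqF // sqrtr_gt0.
exists (col_mx (c *: w) B').
  have Bw : B' *m w^T = 0 by rewrite -[LHS]trmxK trmx_mul trmxK wB trmx0.
  have ww : (c *: w) *m (c *: w)^T = 1%:M.
    rewrite linearZ /= -scalemxAr -scalemxAl [w *m w^T]mx11_scalar scalerA.
    rewrite scale_scalar_mx -expr2 exprVn sqr_sqrtr ?ltW //.
    by rewrite mulVf ?gt_eqF.
  rewrite tr_col_mx mul_col_row oB ww -scalemxAl wB linearZ /= -scalemxAr Bw.
  by rewrite !scaler0 -scalar_mx_block.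
rewrite defU; apply/eqmxP/andP; split; rewrite -!addsmxE !addsmx_sub.
  rewrite eqB addsmxSr andbT scalemx_sub // addmx_sub ?addsmxSl // eqmx_opp.
  by rewrite (submx_trans _ (addsmxSr _ _)) // -eqB submxMl.
rewrite -eqB addsmxSr andbT -[u](subrK (u *m B'^T *m B')) addmx_sub //.
  by rewrite -/w (submx_trans _ (addsmxSl _ _)) // eqmx_scale.
by rewrite (submx_trans _ (addsmxSr _ _)) // submxMl.
Qed.

Lemma orthonormal_eigenbasis_exists (R : rcfType) (T : finType) (e : rel T)
    (l : R) :
  exists B : 'M[R]_(multiplicity e l, #|T|), orthonormal_eigenbasis B.
Proof.
have [B oB eqB] := orthonormal_basis_exists
  (row_base_free (eigenspace (normalized_laplacian R e) l)).
by exists B; split=> //; apply: eqmx_trans eqB (eq_row_base _).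
Qed.

(* Main.v *)
(** For a fixed eigenvalue [l] with orthonormal eigenbasis [B], the edge
    derivative at {x,y} depends on [B] only through the orthogonal projection
    [B^T *m B] onto the eigenspace, which commutes with every automorphism; by
    edge transitivity it takes the same value on all edges.  For each unit
    eigenvector v the first part of the formula sums over all edges to
    (1 - l) |v|^2 = 1 - l, and the second to the quadratic form of
    D^(-1/2) A D^(-1/2) at v, which is 1 - l as well.  The common value is
    therefore 0, for every eigenvalue separately. *)
Require Import Defs.
From mathcomp Require Import all_boot all_order all_algebra all_fingroup.
From mathcomp Require Import ring.

Set Implicit Arguments.
Unset Strict Implicit.
Unset Printing Implicit Defensive.

Import Order.TTheory GRing.Theory Num.Theory.
Local Open Scope ring_scope.

(** The change of basis satisfies [M M^T = C C^T = 1]. Being square, it also satisfies [M^T M = 1],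
    so it cancels in [B^T M^T M B]. *)
Lemma orthonormal_proj_unique (R : comUnitRingType) (k n : nat)
    (B C : 'M[R]_(k, n)) (M : 'M[R]_k) :
  B *m B^T = 1%:M -> C *m C^T = 1%:M -> C = M *m B -> C^T *m C = B^T *m B.
Proof.
move=> oB oC defC.
have MMt : M *m M^T = 1%:M.
  by rewrite -oC defC trmx_mul mulmxA -(mulmxA M) oB mulmx1.
by rewrite defC trmx_mul mulmxA -(mulmxA B^T) (mulmx1C MMt) mulmx1.
Qed.

Section GraphLemmas.

Variables (T : finType) (e : rel T).

Lemma degree_automorphism (s : {perm T}) (x : T) :
  graph_automorphism e s -> degree e (s x) = degree e x.
Proof.
move=> aut_s; rewrite /degree -(card_imset [set y | e x y] (@perm_inj _ s)).
apply: eq_card => z; rewrite inE -[z](permKV s) aut_s mem_imset ?inE //.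
exact: perm_inj.
Qed.

Lemma degree_gt0 (x : T) :
  connected_graph e -> (1 < #|T|)%N -> (0 < degree e x)%N.
Proof.
move=> conn_e T_gt1.
have [a [b [_ _ a_neq_b]]] := card_gt1P T_gt1.
have [y y_neq_x] : exists y, y != x.
  by case: (eqVneq a x) => [ax | ]; [exists b; rewrite eq_sym -ax | exists a].
(* A path from [x] to [y != x] is nonempty, and its first step is a neighbour of [x]. *)
have /connectP[[|z p] /= path_p y_last] := conn_e x y.
  by rewrite y_last eqxx in y_neq_x.
by case/andP: path_p => xz _; apply/card_gt0P; exists z; rewrite inE.
Qed.

Lemma edge_transitive_const (V : Type) (f : T -> T -> V) :
  edge_transitive e -> irreflexive e -> (forall x y, f x y = f y x) ->
  (forall s x y, graph_automorphism e s -> f (s x) (s y) = f x y) ->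
  forall x1 y1 x2 y2, e x1 y1 -> e x2 y2 -> f x1 y1 = f x2 y2.
Proof.
move=> trans_e irr_e fC f_aut x1 y1 x2 y2 e1 e2.
have [s aut_s im_s] := trans_e _ _ _ _ e1 e2.
have e12 : e (s x1) (s y1) by rewrite aut_s.
have in_s z : z \in [set x1; y1] -> s z \in [set x2; y2].
  by move=> ?; rewrite -im_s imset_f.
(* Either [s] preserves the order of the endpoints, or it swaps them and [fC] applies; irreflexivity
   excludes a collapse to one vertex. *)
rewrite -(f_aut s) //; move: (in_s x1 (set21 _ _)) (in_s y1 (set22 _ _)) e12.
by case/set2P=> ->; case/set2P=> ->; rewrite ?irr_e.
Qed.

End GraphLemmas.

Section EigenvalueDerivative.

Variables (R : rcfType) (T : finType) (e : rel T).
Variables (l : R) (B : 'M[R]_(multiplicity e l, #|T|)).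
Hypothesis B_basis : orthonormal_eigenbasis B.

Let P (x y : T) : R := (B^T *m B) (enum_rank x) (enum_rank y).

Lemma normalized_laplacianE (x y : T) :
  normalized_laplacian R e (enum_rank x) (enum_rank y) =
  (x == y)%:R
  - (e x y)%:R / (Num.sqrt (degree e x)%:R * Num.sqrt (degree e y)%:R).
Proof.
rewrite /normalized_laplacian /degree_invsqrt_mx mul_mx_diag mul_diag_mx.
rewrite !mxE !enum_rankK (inj_eq enum_rank_inj) invfM.
by rewrite mulrAC mulrC mulrA.
Qed.

Lemma eigenbasis_eq : B *m normalized_laplacian R e = l *: B.
Proof. by apply/eigenspaceP; case: B_basis => _ eqB; rewrite eqB. Qed.

(** Permuting the columns of [B] along [s] gives another orthonormal basis [C] of the same
    eigenspace, hence the same projection. *)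
Lemma eigenproj_automorphism (s : {perm T}) (x y : T) :
  graph_automorphism e s -> P (s x) (s y) = P x y.
Proof.
move=> aut_s; case: B_basis => oB eqB.
pose f (i : 'I_#|T|) := enum_rank (s (enum_val i)).
have f_inj : injective f.
  by move=> i j /enum_rank_inj/perm_inj/enum_val_inj.
have L_f i j : normalized_laplacian R e (f i) (f j)
               = normalized_laplacian R e i j.
  rewrite -[in RHS](enum_valK i) -[in RHS](enum_valK j) !normalized_laplacianE.
  by rewrite !degree_automorphism // aut_s (inj_eq perm_inj).
pose C := colsub f B.
have oC : C *m C^T = 1%:M.
  rewrite -oB; apply/matrixP=> i j; rewrite !mxE [RHS](reindex_inj f_inj).
  by apply: eq_bigr => k _; rewrite !mxE.
have eigC : C *m normalized_laplacian R e = l *: C.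
  (* Column [f j] of the eigenvector equation for [B], reindexed by [f], is column [j] of the one
     for [C]. *)
  apply/matrixP=> i j; have /matrixP/(_ i (f j)) := eigenbasis_eq.
  rewrite [LHS]mxE [RHS]mxE (reindex_inj f_inj) => eig_j.
  rewrite [LHS]mxE [RHS]mxE [C i j]mxE -eig_j.
  by apply: eq_bigr => k _; rewrite L_f [C i k]mxE.
have /submxP[M defC] : (C <= B)%MS by rewrite eqB; apply/eigenspaceP.
have /matrixP/(_ (enum_rank x) (enum_rank y)) :=
  orthonormal_proj_unique oB oC defC.
rewrite /P => <-; rewrite !mxE; apply: eq_bigr => k _.
by rewrite !mxE /f !enum_rankK.
Qed.

Lemma eigenvalue_derivE (x y : T) :
  eigenvalue_deriv B x y = (multiplicity e l)%:R^-1 *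
    ((1 - l) * (P x x / (degree e x)%:R + P y y / (degree e y)%:R)
     - 2 * (P x y / Num.sqrt ((degree e x)%:R * (degree e y)%:R))).
Proof.
rewrite /eigenvalue_deriv; congr (_ * _).
have PE z t : P z t = \sum_i B i (enum_rank z) * B i (enum_rank t).
  by rewrite /P mxE; apply: eq_bigr => i _; rewrite mxE.
rewrite sumrB -!mulr_sumr big_split -!mulr_suml !PE /=.
under eq_bigr do rewrite expr2.
by under [X in _ + X / _]eq_bigr do rewrite expr2.
Qed.

Lemma eigenvalue_derivC (x y : T) :
  eigenvalue_deriv B x y = eigenvalue_deriv B y x.
Proof.
have PC : P x y = P y x.
  by rewrite /P -[in LHS](trmxK (B^T *m B)) trmx_mul trmxK mxE.
by rewrite !eigenvalue_derivE PC addrC [in RHS]addrC [_%:R * _%:R]mulrC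
  [P x x / _ + _]addrC.
Qed.

Lemma eigenvalue_deriv_automorphism (s : {perm T}) (x y : T) :
  graph_automorphism e s ->
  eigenvalue_deriv B (s x) (s y) = eigenvalue_deriv B x y.
Proof.
move=> aut_s; rewrite !eigenvalue_derivE !eigenproj_automorphism //.
by rewrite !degree_automorphism.
Qed.

(** This is the diagonal entry at [x] of [P L = l P], where [L] is the normalized Laplacian: the
    identity part of [L] contributes [P x x], and the rest is minus the sum over neighbours. *)
Lemma eigenproj_adjacency (x : T) :
  symmetric e ->
  \sum_(y | e x y) P x y / Num.sqrt ((degree e x)%:R * (degree e y)%:R)
  = (1 - l) * P x x.
Proof.
move=> sym_e; have : B^T *m B *m normalized_laplacian R e = l *: (B^T *m B).
  by rewrite -mulmxA eigenbasis_eq -scalemxAr.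
move/matrixP/(_ (enum_rank x) (enum_rank x)).
rewrite [LHS]mxE [RHS]mxE -/(P x x).
rewrite (reindex (enum_rank : T -> _)) /=; last exact/onW_bij/enum_rank_bij.
under eq_bigr do rewrite normalized_laplacianE mulrBr.
rewrite sumrB (bigD1 x) //= eqxx mulr1 -/(P x x) big1 ?addr0; last first.
  by move=> y /negPf->; rewrite mulr0.
move=> eqP; rewrite mulrBl mul1r -eqP subKr [LHS]big_mkcond /=.
apply: eq_bigr => y _; rewrite sym_e sqrtrM ?ler0n // -/(P x y).
by case: (e y x); rewrite ?mul0r ?mulr0 // mul1r [Num.sqrt _ * _]mulrC.
Qed.

(** Each edge is counted in both orders. With [t] the trace of [P], the bracket sums to
    [(1 - l) (t + t) - 2 (1 - l) t], so the value of [t] is irrelevant. *)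
Lemma sum_eigenvalue_deriv :
  symmetric e -> (forall x, 0 < degree e x)%N ->
  \sum_x \sum_(y | e x y) eigenvalue_deriv B x y = 0.
Proof.
move=> sym_e deg_gt0.
have diag : \sum_x \sum_(y | e x y) P x x / (degree e x)%:R = \sum_x P x x.
  apply: eq_bigr => x _; rewrite sumr_const.
  rewrite (_ : #|_| = degree e x); last by apply: eq_card => y; rewrite !inE.
  by rewrite -[LHS]mulr_natr divfK // pnatr_eq0 -lt0n.
have diag' : \sum_x \sum_(y | e x y) P y y / (degree e y)%:R = \sum_x P x x.
  (* Exchanging the two sums turns the [y] term into the [x] term, by symmetry of [e]. *)
  rewrite -diag (exchange_big_dep predT) //=.
  by apply: eq_bigr => x _; apply: eq_bigl => y; rewrite sym_e.
under eq_bigr do under eq_bigr do rewrite eigenvalue_derivE.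
under eq_bigr do rewrite -mulr_sumr sumrB -!mulr_sumr big_split.
rewrite -mulr_sumr sumrB -!mulr_sumr big_split /= diag diag'.
under [X in _ - 2 * X]eq_bigr do rewrite eigenproj_adjacency //.
by rewrite -mulr_sumr; ring.
Qed.

Lemma edge_transitive_eigenvalue_deriv (x y : T) :
  simple_graph e -> (forall z, 0 < degree e z)%N -> edge_transitive e ->
  e x y -> eigenvalue_deriv B x y = 0.
Proof.
move=> [sym_e irr_e] deg_gt0 trans_e exy.
have := sum_eigenvalue_deriv sym_e deg_gt0.
under eq_bigr => z _ do under eq_bigr => t ezt do
  rewrite (edge_transitive_const trans_e irr_e eigenvalue_derivC
             eigenvalue_deriv_automorphism ezt exy).
(* The zero sum is now the common value times the number of ordered adjacent pairs, which is nonzero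
   since [(x, y)] is one of them. *)
rewrite pair_big_dep sumr_const /= => /eqP; rewrite mulrn_eq0 => /orP[|/eqP//].
by move/eqP/card0_eq/(_ (x, y)); rewrite unfold_in /= exy.
Qed.

End EigenvalueDerivative.

Theorem theorem3p2 (R : rcfType) (T : finType) (e : rel T)
    (e_simple : simple_graph e) (e_connected : connected_graph e)
    (T_gt1 : (1 < #|T|)%N) (e_trans : edge_transitive e)
    (B : forall l : R, 'M[R]_(multiplicity e l, #|T|))
    (B_basis : forall l : R, orthonormal_eigenbasis (B l))
    (x y : T) (xy_edge : e x y) :
  kemeny_deriv B x y = 0.
Proof.
rewrite /kemeny_deriv big1 // => l _.
rewrite (edge_transitive_eigenvalue_deriv (B_basis l)) ?mulr0 // => z.
exact: degree_gt0.
Qed.
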